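(* Suppose $X$ is a compact Hausdorff space, and let $A$ be the set of all sequential limit points of $X$. If $X=\overline{A}$, then $X$ is an $\eta$-space.
   Context: A point $x\in X$ is a sequential limit point of $X$ if there is a sequence $\{x_n\}$ in $X\setminus\{x\}$ with $x_n\to x$. $C(X)$ denotes the algebra of complex-valued continuous functions on $X$. A map $T$ on $C(X)$ is additive if $T(f+g)=T(f)+T(g)$ for all $f,g$; it is a multiplication if there is $a\in C(X)$ with $T(f)=af$ for all $f\in C(X)$; it is a local multiplication if for each $f\in C(X)$ there is $a_f\in C(X)$ with $T(f)=a_f f$. A compact Hausdorff space $X$ is an $\eta$-space if every additive local multiplication on $C(X)$ is a multiplication. *)

(* Defs.v *)
From HB Require Import structures.
From mathcomp Require Import all_boot all_order all_algebra.
From mathcomp Require Import all_classical all_reals all_analysis.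
From mathcomp Require Import complex.

Set Implicit Arguments.
Unset Strict Implicit.
Unset Printing Implicit Defensive.

Import Order.TTheory GRing.Theory Num.Theory.
Import numFieldNormedType.Exports.

Local Open Scope classical_set_scope.
Local Open Scope ring_scope.

(* The regular module [R[i]^o] is the form of the complex field on which the
   topology of the modulus is declared: a ball around [z] is
   [w | `|z - w| < e] with [0 < e] in [R[i]], which forces [e] to be real. *)
Definition ctsC (R : realType) (X : topologicalType) : Type :=
  continuousType X (R[i])^o.

Section ContinuousRing.
Context (R : realType) (X : topologicalType).
Implicit Types f g h : ctsC R X.

HB.instance Definition _ := Choice.on (ctsC R X).

Lemma ctsCP f g : (forall x, f x = g x) -> f = g.
Proof. by move=> fg; apply/continuousEP. Qed.

Lemma ctsC_add_subproof f g : continuous (fun x => f x + g x : (R[i])^o).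
Proof.
by move=> x; apply: (@cvgD _ _ _ _ _ f g); exact: cts_fun.
Qed.

Lemma ctsC_opp_subproof f : continuous (fun x => - f x : (R[i])^o).
Proof.
by move=> x; apply: (@cvgN _ _ _ _ _ f); exact: cts_fun.
Qed.

Lemma ctsC_mul_subproof f g : continuous (fun x => f x * g x : (R[i])^o).
Proof.
by move=> x; apply: (@cvgM R[i] _ _ _ f g); exact: cts_fun.
Qed.

Definition ctsC_zero : ctsC R X := cst (0 : (R[i])^o).
Definition ctsC_one : ctsC R X := cst (1 : (R[i])^o).
Definition ctsC_add f g : ctsC R X := mkcts (@ctsC_add_subproof f g).
Definition ctsC_opp f : ctsC R X := mkcts (@ctsC_opp_subproof f).
Definition ctsC_mul f g : ctsC R X := mkcts (@ctsC_mul_subproof f g).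

Lemma ctsC_addA : associative ctsC_add.
Proof. by move=> f g h; apply: ctsCP => x; exact: addrA. Qed.
Lemma ctsC_addC : commutative ctsC_add.
Proof. by move=> f g; apply: ctsCP => x; exact: addrC. Qed.
Lemma ctsC_add0 : left_id ctsC_zero ctsC_add.
Proof. by move=> f; apply: ctsCP => x; exact: add0r. Qed.
Lemma ctsC_addN : left_inverse ctsC_zero ctsC_opp ctsC_add.
Proof. by move=> f; apply: ctsCP => x; exact: addNr. Qed.

HB.instance Definition _ :=
  GRing.isZmodule.Build (ctsC R X) ctsC_addA ctsC_addC ctsC_add0 ctsC_addN.

Lemma ctsC_mulA : associative ctsC_mul.
Proof. by move=> f g h; apply: ctsCP => x; exact: mulrA. Qed.
Lemma ctsC_mulC : commutative ctsC_mul.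
Proof. by move=> f g; apply: ctsCP => x; exact: (@mulrC R[i]). Qed.
Lemma ctsC_mul1 : left_id ctsC_one ctsC_mul.
Proof. by move=> f; apply: ctsCP => x; exact: mul1r. Qed.
Lemma ctsC_mulDl : left_distributive ctsC_mul +%R.
Proof. by move=> f g h; apply: ctsCP => x; exact: mulrDl. Qed.

(* [ComPzRing], not [ComNzRing]: [X] may be empty, and then [0 = 1]. *)
HB.instance Definition _ :=
  GRing.Zmodule_isComPzRing.Build (ctsC R X)
    ctsC_mulA ctsC_mulC ctsC_mul1 ctsC_mulDl.

Lemma ctsCDE f g x : (f + g) x = f x + g x. Proof. by []. Qed.
Lemma ctsCME f g x : (f * g) x = f x * g x. Proof. by []. Qed.

Definition additive_map (T : ctsC R X -> ctsC R X) : Prop :=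
  {morph T : f g / f + g}.

Definition multiplication (T : ctsC R X -> ctsC R X) : Prop :=
  exists a : ctsC R X, forall f : ctsC R X, T f = a * f.

Definition local_multiplication (T : ctsC R X -> ctsC R X) : Prop :=
  forall f : ctsC R X, exists a : ctsC R X, T f = a * f.

End ContinuousRing.

Definition eta_space (R : realType) (X : topologicalType) : Prop :=
  [/\ compact [set: X], hausdorff_space X &
      forall T : ctsC R X -> ctsC R X,
        additive_map T -> local_multiplication T -> multiplication T].

Definition seq_limit_points (X : topologicalType) : set X :=
  [set x | exists u : nat -> X, (forall n, u n <> x) /\ u @ \oo --> x].

(* Main.v *)
Require Import Defs.
From mathcomp Require Import all_boot all_order all_algebra.
From mathcomp Require Import all_classical all_reals all_analysis.
From mathcomp Require Import complex.

Set Implicit Arguments.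
Unset Strict Implicit.
Unset Printing Implicit Defensive.

Import Order.TTheory GRing.Theory Num.Theory.
Import numFieldNormedType.Exports.

Local Open Scope classical_set_scope.
Local Open Scope ring_scope.

(** Subtracting from T the multiplication by T 1 gives an additive local
    multiplication S with S 1 = 0, and the task is to show S = 0.  As every
    S f is continuous and the sequential limit points are dense, it is enough
    to show that S f vanishes at such a point x; fix a sequence u of points
    other than x with u --> x, which may be taken injective.

    Locality makes (S f) y depend on f y alone (apply it to a difference of two
    functions agreeing at y), so for each y there is an additive, hence
    Q-linear, map phi_y of the complex field with (S f) y = phi_y (f y) and
    phi_y 1 = 0 ([local_mult_eq], [local_mult_eqMn]).  A priori phi_y may be
    a wild additive map; it is the freedom to prescribe values along u that
    excludes this at x.  By Tietze's theorem ([continuous_extend_seq]) there is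
    a continuous g with

      g (u n) = 1 / (n + 1)         for n even,
      g (u n) = f (u n) / (n + 1)   for n odd,

    because these values tend to 0.  Write S g = a g with a continuous.  At
    even n, phi vanishes on rationals, so a (u n) = 0, and a x = 0 by
    continuity.  At odd n, the factor 1 / (n + 1) cancels from
    phi (g (u n)) = a (u n) g (u n) by Q-linearity, which leaves
    S f (u n) = a (u n) f (u n).  Letting n grow along the odd integers,
    S f x = a x * f x = 0. *)

(** * Convergent sequences in Hausdorff spaces *)

(** Finite sets are closed, so a point has a neighbourhood that misses any
    finitely many points other than itself.  The point y may be a value of u;
    this is why the conclusion is z = y and not an absurdity. *)
Lemma near_avoid_finite (X : topologicalType) (u : nat -> X) (y : X) (N : nat) :
  hausdorff_space X ->
  \forall z \near y, forall i, (i < N)%N -> u i = z -> z = y.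
Proof.
move=> /hausdorff_accessible /accessible_finite_set_closed closed_fin.
pose F := [set u i | i in `I_N] `\ y.
have clF : closed F.
  by apply: closed_fin; apply: finite_setD; apply: finite_image; exact: finite_II.
have : nbhs y (~` F).
  by apply: open_nbhs_nbhs; split; [exact: closed_openC | case=> _; apply].
apply: filterS => z nFz i iN uiz; apply: contrapT => zy.
by apply: nFz; split => //; exists i.
Qed.

(** Separating y from x leaves only finitely many terms of u near y.  One
    statement serves two purposes: for y outside the set x |` range u, it says
    that this set is closed; for y inside, that y is isolated in it. *)
Lemma near_cvg_isolated (X : topologicalType) (u : nat -> X) (x y : X) :
  hausdorff_space X -> u @ \oo --> x -> y <> x ->
  \forall z \near y, (x |` range u) z -> z = y.
Proof.
move=> hX ux /eqP yx.
have := hX; rewrite open_hausdorff => /(_ y x yx)[[A B] /= [/set_mem yA /set_mem xB]].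
move=> [oA oB /eqP AB0].
have [N _ uB] : \forall n \near \oo, B (u n).
  by apply: ux; exact: open_nbhs_nbhs.
have nA : nbhs y A by exact: open_nbhs_nbhs.
apply: filterS2 nA (@near_avoid_finite X u y N hX) => z zA zF.
have zNB : ~ B z by move=> zB; have : (A `&` B) z by []; rewrite AB0.
case=> [/= zx|[n _ unz]]; first by rewrite zx in zNB.
apply: (zF n) => //; rewrite ltnNge; apply/negP => Nn.
by apply: zNB; rewrite -unz; exact: uB.
Qed.

(** After any index m, the sequence eventually leaves the finite set of its
    first terms, none of which is the limit.  Iterating this choice of a later
    index produces pairwise distinct terms. *)
Lemma cvg_injective_subseq (X : topologicalType) (u : nat -> X) (x : X) :
  hausdorff_space X -> (forall n, u n <> x) -> u @ \oo --> x ->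
  exists v : nat -> X,
    [/\ injective v, forall n, v n <> x & v @ \oo --> x].
Proof.
move=> hX unx ux.
have next m : exists k, (m < k)%N /\
    forall n i, (k <= n)%N -> (i <= m)%N -> u n <> u i.
  have [k _ uk] := ux _ (@near_avoid_finite X u x m.+1 hX).
  exists (maxn k m.+1); split=> [|n i]; first exact: leq_maxr.
  rewrite geq_max => /andP[kn _] im uni.
  by apply: (unx n); apply: (uk n kn i).
have [N HN] := choice next.
pose e n := iter n N 0%N.
have eS n : e n.+1 = N (e n) by [].
have emono : {homo e : m n / (m < n)%N}.
  by apply: homo_ltn => [? ? ?|n]; [exact: ltn_trans | rewrite eS; exact: (HN _).1].
have ele m n : (m <= n)%N -> (e m <= e n)%N.
  by rewrite leq_eqVlt => /predU1P[->//|/emono/ltnW].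
have ne m n : (m < n)%N -> u (e n) <> u (e m).
  move=> mn; apply: (HN (e m)).2 => //.
  by rewrite -eS; exact: ele.
exists (u \o e); split=> [m n /= uemn|n|]; last 1 first.
- apply: cvg_comp ux => A [k _ kA]; exists k => // n /= kn; apply: kA => /=.
  apply: (leq_trans kn); elim: n {kn} => // n IH.
  exact: leq_ltn_trans IH (emono _ _ (ltnSn n)).
- by case: (ltngtP m n) => // /ne; rewrite uemn.
- exact: unx.
Qed.

(** * Prescribing values along a convergent sequence *)

Lemma real_complex_continuous (R : realType) :
  continuous ((fun r : R => r%:C%C) : R^o -> R[i]^o).
Proof.
move=> r; apply/cvgrPdist_lt => e e0.
have [d eE] : exists d : R, e = d%:C%C.
  by exists (complex.Re e); rewrite RRe_real// gtr0_real.
rewrite eE in e0 *; rewrite ltcR in e0.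
have /cvgrPdist_lt/(_ d e0) : (id : R^o -> R^o) @ r --> r by exact: cvg_id.
apply: filterS => t /= rtd.
by rewrite -rmorphB /= normc_def /= expr0n /= addr0 sqrtr_sqr ltcR.
Qed.

(** The set K formed by x and the values of u is closed, and the function
    sending u n to c n and x to 0 is continuous on it: each u n is isolated
    in K, and continuity at x is the convergence of c to 0.  Tietze's theorem
    extends it to X. *)
Lemma continuous_extend_seq (R : realType) (X : topologicalType)
    (u : nat -> X) (x : X) (c : nat -> R) :
  compact [set: X] -> hausdorff_space X ->
  injective u -> (forall n, u n <> x) -> u @ \oo --> x ->
  c @ \oo --> 0 ->
  exists p : ctsC R X, forall n, p (u n) = (c n)%:C%C.
Proof.
move=> cX hX uI unx ux c0.
(* Injectivity of u makes the chosen index of a point of the sequence the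
   original one; the default value 0 is the value wanted at x. *)
pose f y : R^o := if pselect (exists n, u n = y) is left h
                  then c (projT1 (cid h)) else 0.
have fu n : f (u n) = c n.
  rewrite /f; case: pselect => [h|[]]; last by exists n.
  by congr c; apply: uI; exact: projT2 (cid h).
have fx : f x = 0.
  by rewrite /f; case: pselect => // h; have [n /unx] := h.
pose K := x |` range u.
have clK : closed K.
  move=> y clKy; have [->|yx] := pselect (y = x); first by left.
  by have [z [Kz /(_ Kz) <-]] := clKy _ (near_cvg_isolated hX ux yx).
have cf : {within K, continuous f}.
  apply/subspace_continuousP => y Ky.
  have [->|yx] := pselect (y = x); last first.
    apply: cvg_near_cst; rewrite /within /=.
    by apply: filterS (near_cvg_isolated hX ux yx) => z + Kz => /(_ Kz) ->.
  rewrite /from_subspace fx; apply/cvgrPdist_lt => e e0.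
  move/cvgrPdist_lt: c0 => /(_ e e0)[N _ cN].
  rewrite /within /=.
  apply: filterS (@near_avoid_finite X u x N hX) => z zF [/= ->|[n _ unz]].
    by rewrite fx subrr normr0.
  rewrite -unz fu; apply: cN => /=; rewrite leqNgt; apply/negP => nN.
  by apply: (unx n); rewrite unz; exact: (zF n).
have [M [M0 cM]] : exists M : R, 0 < M /\ forall n, `|c n| <= M.
  have /(@cvg_seq_bounded R R^o)[M [_ cM]] : cvgn (c : nat -> R^o) by apply: cvgP c0.
  exists (Num.max 0 M + 1); split; first by rewrite ltr_wpDl// le_max lexx.
  move=> n; apply: cM => //.
  by rewrite (@le_lt_trans _ _ (Num.max 0 M))// ?le_max ?lexx ?orbT// ltrDl.
have fM y : K y -> `|f y| <= M.
  by move=> [->|[n _ <-]]; rewrite ?fx ?fu// normr0 ltW.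
have [g [fg cg _]] := continuous_bounded_extension (compact_normal hX cX) clK M0 cf fM.
have cp : continuous (fun y => (g y)%:C%C : R[i]^o).
  move=> y; apply: continuous_comp; [exact: cg | exact: real_complex_continuous].
exists (mkcts cp) => n.
have <- // : g (u n) = c n.
by rewrite -fu; apply/esym/fg; rewrite inE; right; exists n.
Qed.

(** * Zero sets and additive local multiplications *)

Lemma closed_zero_set (R : realType) (X : topologicalType) (f : ctsC R X) :
  closed [set y | f y = 0].
Proof.
have -> : [set y | f y = 0] = f @^-1` [set 0] by [].
apply: (@closed_comp _ _ f) => [y _|]; first exact: cts_fun.
exact/accessible_closed_set1/hausdorff_accessible/norm_hausdorff.
Qed.

Lemma zero_at_seq_limit (R : realType) (X : topologicalType) (f : ctsC R X)
    (u : nat -> X) (x : X) :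
  u @ \oo --> x -> (forall n, f (u n) = 0) -> f x = 0.
Proof.
move=> ux fu0; have fu : \forall n \near \oo, [set y | f y = 0] (u n) by exact: nearW.
exact: (closed_cvg _ (@closed_zero_set _ _ f) fu x ux).
Qed.

Lemma ctsCBE (R : realType) (X : topologicalType) (f g : ctsC R X) y :
  (f - g) y = f y - g y.
Proof. by []. Qed.

Section AdditiveLocal.
Context (R : realType) (X : topologicalType) (S : ctsC R X -> ctsC R X).
Context (addS : additive_map S) (locS : local_multiplication S).
Implicit Types f g : ctsC R X.

Lemma additive_map0 : S 0 = 0.
Proof. by apply: (addrI (S 0)); rewrite -addS !addr0. Qed.

Lemma additive_mapN f : S (- f) = - S f.
Proof. by apply: (addrI (S f)); rewrite -addS !subrr additive_map0. Qed.

Lemma additive_mapMn f n : S (f *+ n) = S f *+ n.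
Proof.
by elim: n => [|n IH]; rewrite ?mulr0n ?additive_map0// !mulrS addS IH.
Qed.

Lemma ctsCMn f n y : (f *+ n) y = f y *+ n.
Proof. by elim: n => [|n IH]; rewrite ?mulr0n// !mulrS ctsCDE IH. Qed.

(** S (f - g) is a multiple of f - g, so it vanishes where f and g agree. *)
Lemma local_mult_eq f g y : f y = g y -> S f y = S g y.
Proof.
move=> fgy; have [a Sfg] := locS (f - g).
apply/eqP; rewrite -subr_eq0 -ctsCBE -additive_mapN -addS Sfg ctsCME.
by rewrite ctsCBE fgy subrr mulr0.
Qed.

(** The pointwise maps induced by S commute with division by integers; stated
    without division so that no function f / n has to be formed. *)
Lemma local_mult_eqMn f g y n : f y *+ n = g y -> S f y *+ n = S g y.
Proof.
move=> fgy; rewrite -ctsCMn -additive_mapMn.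
by apply: local_mult_eq; rewrite ctsCMn.
Qed.

End AdditiveLocal.

(** The decisive step: a single g interleaves, along a sequence converging
    to x, rational values (where S vanishes, since S 1 = 0) with rational
    multiples of the values of f, and the continuous multiplier of S g has to
    serve both. *)
Lemma local_mult_eq0_at_seq_limit (R : realType) (X : topologicalType)
    (S : ctsC R X -> ctsC R X) (f : ctsC R X) (x : X) :
  compact [set: X] -> hausdorff_space X ->
  additive_map S -> local_multiplication S -> S 1 = 0 ->
  seq_limit_points x -> S f x = 0.
Proof.
move=> cX hX addS locS S1 [u0 [u0x /(cvg_injective_subseq hX u0x)]].
move=> [u [uI unx ux]].
have parity_cvg (b : bool) : u (n.*2 + b)%N @[n --> \oo] --> x.
  apply: (cvg_comp (fun n => n.*2 + b)%N _ _ ux) => A [k _ kA].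
  exists k => // n /= kn; apply: kA => /=.
  by rewrite -addnn -addnA (leq_trans kn)// leq_addr.
have bump (b : bool) : exists p : ctsC R X, forall n,
    p (u n) = (if odd n == b then harmonic n else 0 : R)%:C%C.
  apply: (continuous_extend_seq cX hX uI unx ux).
  apply/(@cvgrPdist_lt R R^o) => e e0.
  have /(@cvgrPdist_lt R R^o)/(_ e e0) := @cvg_harmonic R.
  by apply: filterS => n; case: ifP => //= _ _; rewrite subrr normr0.
have [h hE] := choice bump.
have hMn b n : h b (u (n.*2 + b)%N) *+ (n.*2 + b).+1 = 1.
  rewrite hE oddD odd_double oddb eqxx -rmorphMn.
  have -> // : (harmonic (n.*2 + b)%N : R) *+ (n.*2 + b).+1 = 1.
  by rewrite -mulr_natr mulVf// pnatr_eq0.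
have h0 b n : h b (u (n.*2 + ~~ b)%N) = 0.
  by rewrite hE oddD odd_double; case: b.
(* Even terms carry 1 / (n + 1), odd terms f / (n + 1). *)
pose g := h false + h true * f.
have [a Sg] := locS g.
have a0 : a x = 0.
  apply: zero_at_seq_limit (parity_cvg false) _ => n; set y := u _.
  have gy : g y *+ (n.*2 + false).+1 = 1.
    by rewrite /g ctsCDE ctsCME (h0 true) mul0r addr0 (hMn false).
  have /eqP := local_mult_eqMn addS locS (g := 1) gy.
  rewrite S1 mulrn_eq0 /= Sg ctsCME mulf_eq0 => /orP[/eqP//|/eqP gy0].
  by move/eqP: gy; rewrite gy0 mul0rn eq_sym oner_eq0.
have : (S f - a * f) x = 0.
  apply: zero_at_seq_limit (parity_cvg true) _ => n; set y := u _.
  have gy : g y *+ (n.*2 + true).+1 = f y.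
    by rewrite /g ctsCDE ctsCME (h0 false) add0r -mulrnAl (hMn true) mul1r.
  by rewrite ctsCBE -(local_mult_eqMn addS locS gy) Sg !ctsCME -mulrnAr gy subrr.
by rewrite ctsCBE ctsCME a0 mul0r subr0.
Qed.

Theorem theorem2 (R : realType) (X : topologicalType)
    (cptX : compact [set: X]) (hausX : hausdorff_space X)
    (denseA : [set: X] = closure (@seq_limit_points X)) :
  eta_space R X.
Proof.
split=> // T addT locT; exists (T 1) => f.
pose S g := T g - T 1 * g.
have addS : additive_map S.
  by move=> g1 g2; rewrite /S addT mulrDr opprD addrACA.
have locS : local_multiplication S.
  by move=> g; have [a Tg] := locT g; exists (a - T 1); rewrite /S Tg mulrBl.
have S1 : S 1 = 0 by rewrite /S mulr1 subrr.
apply/eqP; rewrite -subr_eq0; apply/eqP/ctsCP => x.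
apply: (closed_zero_set (f := S f)).
have : closure (@seq_limit_points X) x by rewrite -denseA.
apply: closure_subset => y.
exact: local_mult_eq0_at_seq_limit.
Qed.
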